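(* Let $R$ be a ring, and for any ring $S$ let $NC(S)$ denote the set of all nil-clean elements of $S$. Then: (1) $R$ is a $2$-primal ring if and only if $NC(R[x]) = NC(R) + Nil_*(R)[x]\,x$. (2) $R$ is a $2$-primal ring if and only if $NC(R[x,x^{-1}]) = Nil_*(R)[x,x^{-1}]\,x^{-1} + NC(R) + Nil_*(R)[x,x^{-1}]\,x$. (3) $R$ is a $2$-primal ring if and only if $NC(R[[x]]) \subseteq NC(R) + Nil_*(R)[[x]]\,x$.
   Context: Rings are associative with identity, not necessarily commutative. An element of a ring is nil-clean if it is the sum of an idempotent and a nilpotent element (not required to commute). $Nil_*(R)$ denotes the prime radical (lower nilradical) of $R$. A ring $R$ is $2$-primal if $Nil_*(R)$ equals the set $Nil(R)$ of all nilpotent elements of $R$. $R[x]$, $R[x,x^{-1}]$, $R[[x]]$ are the polynomial, Laurent polynomial and formal power series rings in a central indeterminate $x$. For an ideal $I$ of $R$, $I[x]$, $I[x,x^{-1}]$, $I[[x]]$ are the sets of elements of the corresponding rings all of whose coefficients lie in $I$; $I[x]x$ means $\{fx : f\in I[x]\}$, and similarly in the other cases. Sums of sets are elementwise sums. *)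

(* Defs.v *)
From HB Require Import structures.
From mathcomp Require Import all_boot all_order all_algebra.
From mathcomp Require Import finmap monalg.
From mathcomp Require Import boolp classical_sets.

Set Implicit Arguments.
Unset Strict Implicit.
Unset Printing Implicit Defensive.

Import GRing.Theory.

Local Open Scope classical_set_scope.
Local Open Scope ring_scope.

Definition sumset (V : zmodType) (A B : set V) : set V :=
  [set a + b | a in A & b in B].

Notation "A [+] B" := (sumset A B)
  (at level 50, left associativity) : classical_set_scope.

Definition idempotents (S : pzRingType) : set S := [set e | e * e = e].

Definition nilpotents (S : pzRingType) : set S :=
  [set a | exists n : nat, a ^+ n = 0].

Arguments idempotents : clear implicits.
Arguments nilpotents : clear implicits.

Definition NC (S : pzRingType) : set S := idempotents S [+] nilpotents S.

Arguments NC : clear implicits.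

(* MathComp's ring_quotient only covers one-sided, decidable ideals and
   completely prime ones; here ideals are two-sided and arbitrary, and
   primeness is the noncommutative notion: I J `<=` P entails I `<=` P or
   J `<=` P. *)
Definition two_sided_ideal (S : pzRingType) (I : set S) : Prop :=
  [/\ I 0,
      forall a b, I a -> I b -> I (a - b),
      forall r a, I a -> I (r * a)
    & forall r a, I a -> I (a * r)].

Definition prime_ideal (S : pzRingType) (P : set S) : Prop :=
  [/\ two_sided_ideal P,
      P <> setT
    & forall I J : set S, two_sided_ideal I -> two_sided_ideal J ->
        (forall a b, I a -> J b -> P (a * b)) -> I `<=` P \/ J `<=` P].

Definition prime_radical (S : pzRingType) : set S :=
  \bigcap_(P in [set P | prime_ideal P]) P.

Arguments prime_radical : clear implicits.

Definition two_primal (S : pzRingType) : Prop :=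
  prime_radical S = nilpotents S.

Definition poly_coefs_in (R : nzRingType) (I : set R) : set {poly R} :=
  [set f | forall i, I f`_i].

(* A Laurent polynomial is a finitely supported family of coefficients indexed
   by int; f@_k is the coefficient of x^k. The additive group is that of
   {malg R[int]}. The ring structure of monalg is not available, since it
   excludes exponent monoids with nontrivial units. *)
Definition laurent (R : nzRingType) : Type := {malg R[int]}.

Section LaurentRing.
Variable R : nzRingType.

HB.instance Definition _ := GRing.Zmodule.on (laurent R).

Implicit Types f g h : laurent R.

Definition laurent_monom (c : R) (k : int) : laurent R := << c *g k >>.

Fact laurent_monom0 k : laurent_monom 0 k = 0.
Proof. exact: monalgU0. Qed.

Fact laurent_monomD k : {morph laurent_monom^~ k : c d / c + d}.
Proof. exact: monalgUD. Qed.

Fact laurentE f : f = \sum_(i <- msupp f) laurent_monom f@_i i.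
Proof. exact: monalgE. Qed.

Definition laurent_mul f g : laurent R :=
  \sum_(i <- msupp f) \sum_(j <- msupp g) laurent_monom (f@_i * g@_j) (i + j).

Definition laurent_one : laurent R := laurent_monom 1 0.

Fact laurent_mulw (d1 d2 : {fset int}) f g :
  (msupp f `<=` d1)%fset -> (msupp g `<=` d2)%fset ->
  laurent_mul f g =
    \sum_(i <- d1) \sum_(j <- d2) laurent_monom (f@_i * g@_j) (i + j).
Proof.
move=> le1 le2; rewrite /laurent_mul (big_fset_incl _ le1) /=.
  apply: eq_bigr => k1 _; apply: big_fset_incl => // k _ /mcoeff_outdom ->.
  by rewrite mulr0 laurent_monom0.
move=> k _ /mcoeff_outdom fk.
by rewrite big1 => // k' _; rewrite fk mul0r laurent_monom0.
Qed.

Fact laurent_mulUU (c1 c2 : R) (i j : int) :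
  laurent_mul (laurent_monom c1 i) (laurent_monom c2 j)
    = laurent_monom (c1 * c2) (i + j).
Proof.
by rewrite (laurent_mulw msuppU_le msuppU_le) !big_seq_fset1 !mcoeffUU.
Qed.

Fact laurent_mulDl : left_distributive laurent_mul +%R.
Proof.
move=> f g h.
rewrite (laurent_mulw (msuppD_le f g) (fsubset_refl (msupp h))).
rewrite (laurent_mulw (fsubsetUl _ (msupp g)) (fsubset_refl (msupp h))).
rewrite (laurent_mulw (fsubsetUr (msupp f) _) (fsubset_refl (msupp h))).
rewrite -big_split /=; apply: eq_bigr => i _.
rewrite -big_split /=; apply: eq_bigr => j _.
by rewrite mcoeffD mulrDl laurent_monomD.
Qed.

Fact laurent_mulDr : right_distributive laurent_mul +%R.
Proof.
move=> f g h.
rewrite (laurent_mulw (fsubset_refl (msupp f)) (msuppD_le g h)).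
rewrite (laurent_mulw (fsubset_refl (msupp f)) (fsubsetUl _ (msupp h))).
rewrite (laurent_mulw (fsubset_refl (msupp f)) (fsubsetUr (msupp g) _)).
rewrite -big_split /=; apply: eq_bigr => i _.
rewrite -big_split /=; apply: eq_bigr => j _.
by rewrite mcoeffD mulrDr laurent_monomD.
Qed.

Fact laurent_mul0l f : laurent_mul 0 f = 0.
Proof. by rewrite /laurent_mul msupp0 big_seq_fset0. Qed.

Fact laurent_mul0r f : laurent_mul f 0 = 0.
Proof.
by rewrite /laurent_mul big1 // => i _; rewrite msupp0 big_seq_fset0.
Qed.

Fact laurent_mul1l : left_id laurent_one laurent_mul.
Proof.
move=> f; rewrite (laurent_mulw msuppU_le (fsubset_refl _)) big_seq_fset1.
rewrite [RHS]laurentE; apply: eq_bigr => i _.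
by rewrite mcoeffUU mul1r add0r.
Qed.

Fact laurent_mul1r : right_id laurent_one laurent_mul.
Proof.
move=> f; rewrite (laurent_mulw (fsubset_refl _) msuppU_le).
rewrite [RHS]laurentE; apply: eq_bigr => i _.
by rewrite big_seq_fset1 mcoeffUU mulr1 addr0.
Qed.

Let laurent_suml (I : Type) (r : seq I) (F : I -> laurent R) g :
  laurent_mul (\sum_(i <- r) F i) g = \sum_(i <- r) laurent_mul (F i) g.
Proof.
exact: (big_morph (laurent_mul^~ g) (fun x y => laurent_mulDl x y g)
  (laurent_mul0l g)).
Qed.

Let laurent_sumr (I : Type) (r : seq I) (F : I -> laurent R) g :
  laurent_mul g (\sum_(i <- r) F i) = \sum_(i <- r) laurent_mul g (F i).
Proof.
exact: (big_morph (laurent_mul g) (laurent_mulDr g) (laurent_mul0r g)).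
Qed.

Fact laurent_mulA : associative laurent_mul.
Proof.
move: laurent_suml laurent_sumr laurent_mulUU.
move: laurent_mul => m suml sumr mUU f g h.
rewrite (laurentE f) (laurentE g) (laurentE h) !suml; apply: eq_bigr => i _.
rewrite [LHS]sumr [m (laurent_monom _ _) _ in RHS]sumr suml.
apply: eq_bigr => j _.
by rewrite !sumr; apply: eq_bigr => k _; rewrite !mUU mulrA addrA.
Qed.

Fact laurent_one_neq0 : laurent_one != 0.
Proof. by rewrite monalgU_eq0 oner_eq0. Qed.

HB.instance Definition _ := GRing.Zmodule_isNzRing.Build (laurent R)
  laurent_mulA laurent_mul1l laurent_mul1r laurent_mulDl laurent_mulDr
  laurent_one_neq0.

Definition laurentC (c : R) : laurent R := laurent_monom c 0.
Definition laurentX : laurent R := laurent_monom 1 1.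
Definition laurentXV : laurent R := laurent_monom 1 (- 1).

Lemma laurentXK : laurentX * laurentXV = 1 /\ laurentXV * laurentX = 1.
Proof. by split; rewrite [LHS]laurent_mulUU mulr1. Qed.

Definition laurent_coefs_in (I : set R) : set (laurent R) :=
  [set f | forall k : int, I (f@_k)].

End LaurentRing.

Arguments laurentX {R}.
Arguments laurentXV {R}.

(* A wrapper around nat -> R, so that the Cauchy product does not compete with
   the pointwise product of functions. *)
Record fps (R : nzRingType) := FPS { fps_coef :> nat -> R }.

HB.instance Definition _ (R : nzRingType) := [isNew for @fps_coef R].
HB.instance Definition _ (R : nzRingType) := [Choice of fps R by <:].

Section FPSRing.
Variable R : nzRingType.
Implicit Types f g h : fps R.

Lemma fpsP f g : (forall n, f n = g n) <-> f = g.
Proof.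
by case: f g => f [g]; split=> [/= fg|->//]; congr FPS; apply/funext.
Qed.

Definition fps_zero : fps R := FPS (fun=> 0).
Definition fps_opp f : fps R := FPS (fun n => - f n).
Definition fps_add f g : fps R := FPS (fun n => f n + g n).
Definition fps_one : fps R := FPS (fun n => (n == 0%N)%:R).
Definition fps_mul f g : fps R :=
  FPS (fun n => \sum_(i < n.+1) f i * g (n - i)%N).

Fact fps_addA : associative fps_add.
Proof. by move=> f g h; apply/fpsP => n /=; rewrite addrA. Qed.

Fact fps_addC : commutative fps_add.
Proof. by move=> f g; apply/fpsP => n /=; rewrite addrC. Qed.

Fact fps_add0 : left_id fps_zero fps_add.
Proof. by move=> f; apply/fpsP => n /=; rewrite add0r. Qed.

Fact fps_addN : left_inverse fps_zero fps_opp fps_add.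
Proof. by move=> f; apply/fpsP => n /=; rewrite addNr. Qed.

HB.instance Definition _ := GRing.isZmodule.Build (fps R)
  fps_addA fps_addC fps_add0 fps_addN.

Let approx n f (p : {poly R}) := forall i, (i <= n)%N -> p`_i = f i.

Let approx_poly n f : approx n f (\poly_(i < n.+1) f i).
Proof. by move=> i le_in; rewrite coef_poly ltnS le_in. Qed.

Let approxM n f g p q :
  approx n f p -> approx n g q -> approx n (fps_mul f g) (p * q).
Proof.
move=> pf qg i le_in; rewrite coefM /=; apply: eq_bigr => j _.
rewrite pf ?qg //; first exact: leq_trans (leq_subr _ _) le_in.
by apply: leq_trans le_in; rewrite -ltnS.
Qed.

Let approx1 n : approx n fps_one 1.
Proof. by move=> i _; rewrite coef1. Qed.

Fact fps_mulA : associative fps_mul.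
Proof.
move=> f g h; apply/fpsP => n.
have [pf [pg ph]] :=
  (approx_poly (n := n) f, (approx_poly (n := n) g, approx_poly (n := n) h)).
rewrite -(approxM pf (approxM pg ph) (leqnn n)).
by rewrite -(approxM (approxM pf pg) ph (leqnn n)) mulrA.
Qed.

Fact fps_mul1l : left_id fps_one fps_mul.
Proof.
move=> f; apply/fpsP => n; have pf := approx_poly (n := n) f.
by rewrite -(approxM (@approx1 n) pf (leqnn n)) mul1r pf.
Qed.

Fact fps_mul1r : right_id fps_one fps_mul.
Proof.
move=> f; apply/fpsP => n; have pf := approx_poly (n := n) f.
by rewrite -(approxM pf (@approx1 n) (leqnn n)) mulr1 pf.
Qed.

Fact fps_mulDl : left_distributive fps_mul +%R.
Proof.
move=> f g h; apply/fpsP => n /=.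
by rewrite -big_split; apply: eq_bigr => i _; rewrite mulrDl.
Qed.

Fact fps_mulDr : right_distributive fps_mul +%R.
Proof.
move=> f g h; apply/fpsP => n /=.
by rewrite -big_split; apply: eq_bigr => i _; rewrite mulrDr.
Qed.

Fact fps_one_neq0 : fps_one != 0.
Proof. by apply/eqP => /fpsP/(_ 0%N) /= /eqP; rewrite oner_eq0. Qed.

HB.instance Definition _ := GRing.Zmodule_isNzRing.Build (fps R)
  fps_mulA fps_mul1l fps_mul1r fps_mulDl fps_mulDr fps_one_neq0.

Definition fpsC (c : R) : fps R := FPS (fun n => c *+ (n == 0%N)).
Definition fpsX : fps R := FPS (fun n => (n == 1%N)%:R).

Definition fps_coefs_in (I : set R) : set (fps R) :=
  [set f | forall n : nat, I (f n)].

End FPSRing.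

Arguments fpsX {R}.

(* Main.v *)
(* Let N be the prime radical. In all three rings, if R is 2-primal then N is a
   reduced ideal, so comparing lowest coefficients modulo N shows that a
   nilpotent element has all its coefficients in N, and an idempotent all its
   nonconstant ones. The constant part is nil-clean in R as the image under a
   homomorphism to R: evaluation at 0, or at 1 for Laurent polynomials.
   Conversely a prime ideal of R[x] or of R[x, x^-1] contracts to a prime ideal
   of R, hence N[x] and N[x, x^-1] lie in the prime radical of the extension,
   which is nil; adding such an element and a constant nilpotent (an element
   of N) to a constant idempotent gives a nil-clean element.
   Finally, if a is nilpotent in R then so is a x, and each of the three
   descriptions of nil-clean elements forces its coefficient a to be in N. *)

Require Import Defs.
From HB Require Import structures.
From mathcomp Require Import all_boot all_order all_algebra.
From mathcomp Require Import finmap monalg zify.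
From mathcomp Require Import boolp classical_sets.

Set Implicit Arguments.
Unset Strict Implicit.
Unset Printing Implicit Defensive.

Import Order.TTheory GRing.Theory Num.Theory.

Local Open Scope classical_set_scope.
Local Open Scope ring_scope.

(** * Two-sided ideals and annihilators modulo an ideal *)

Section Ideals.
Variables (S : pzRingType) (I : set S).
Hypothesis idI : two_sided_ideal I.

Lemma ideal0 : I 0. Proof. by case: idI. Qed.

Lemma idealB a b : I a -> I b -> I (a - b).
Proof. by case: idI => _ + _ _; apply. Qed.

Lemma idealMl r a : I a -> I (r * a).
Proof. by case: idI => _ _ + _; apply. Qed.

Lemma idealMr r a : I a -> I (a * r).
Proof. by case: idI => _ _ _; apply. Qed.

Lemma idealN a : I a -> I (- a).
Proof. by rewrite -sub0r; apply: idealB; exact: ideal0. Qed.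

Lemma idealD a b : I a -> I b -> I (a + b).
Proof. by move=> Ia /idealN Ib; rewrite -[b]opprK; exact: idealB. Qed.

Lemma ideal_congr a b : I (a - b) -> I a -> I b.
Proof. by move=> Iab Ia; rewrite -(subKr a b); exact: idealB. Qed.

Lemma ideal_sum (T : eqType) (r : seq T) (P : pred T) (F : T -> S) :
  (forall i, i \in r -> P i -> I (F i)) -> I (\sum_(i <- r | P i) F i).
Proof.
move=> IF; rewrite big_seq_cond; apply: big_ind; first exact: ideal0.
- exact: idealD.
- by move=> i /andP[]; exact: IF.
Qed.

(** Modulo [I] this is the right annihilator of [a S]; the next lemma treats a left annihilator.
    Together they replace principal ideals, avoiding finite sums of products [r * a * s]. *)
Lemma two_sided_ideal_transporter (a : S) :
  two_sided_ideal [set x | forall r, I (a * r * x)].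
Proof.
split => /=.
- by move=> r; rewrite mulr0; exact: ideal0.
- by move=> x y Ix Iy r; rewrite mulrBr; exact: idealB.
- by move=> r x Ix s; rewrite mulrA -(mulrA a).
- by move=> r x Ix s; rewrite mulrA; exact: idealMr.
Qed.

Lemma two_sided_ideal_residual (J : set S) : two_sided_ideal J ->
  two_sided_ideal [set x | forall u, J u -> I (x * u)].
Proof.
move=> [_ _ JMl _]; split => /=.
- by move=> u _; rewrite mul0r; exact: ideal0.
- by move=> a b Ia Ib u Ju; rewrite mulrBl; apply: idealB; auto.
- by move=> r a Ia u Ju; rewrite -mulrA; apply/idealMl/Ia.
- by move=> r a Ia u Ju; rewrite -mulrA; apply/Ia/JMl.
Qed.

End Ideals.

(** * Prime ideals and nilness of the prime radical *)

Section PrimeIdeals.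
Variable S : pzRingType.
Implicit Types (P : set S) (a b : S).

Lemma prime_idealP P : two_sided_ideal P -> P <> setT ->
  prime_ideal P <->
    (forall a b, (forall r, P (a * r * b)) -> P a \/ P b).
Proof.
move=> idP PT; split=> [[_ _ primeP] a b Pab|primeP].
  pose J := [set y | forall r, P (a * r * y)].
  have idJ : two_sided_ideal J by exact: two_sided_ideal_transporter.
  pose K := [set x | forall y, J y -> P (x * y)].
  have idK : two_sided_ideal K by exact: two_sided_ideal_residual.
  case: (primeP K J idK idJ) => [x y Kx Jy||]; first exact: Kx.
    (* [a] is in [K]: for [y] in [J], take [r = 1] in the definition of [J]. *)
    by move=> KP; left; apply: KP => y Jy; rewrite -[a]mulr1.
  by move=> JP; right; apply: JP.
split=> // I J idI idJ PIJ.
apply: contrapT => /not_orP[/existsNP[a /not_implyP[Ia nPa]]].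
move=> /existsNP[b /not_implyP[Jb nPb]].
by case: (primeP a b) => // r; apply: PIJ => //; exact: idealMr.
Qed.

Lemma two_sided_ideal_prime_radical : two_sided_ideal (prime_radical S).
Proof.
split=> [P [] /ideal0//|a b Na Nb P PP|r a Na P PP|r a Na P PP].
- by case: (PP) => + _ _ => /idealB; apply; [exact: Na|exact: Nb].
- by case: (PP) => + _ _ => /idealMl; apply; exact: Na.
- by case: (PP) => + _ _ => /idealMr; apply; exact: Na.
Qed.

Lemma maximal_ideal_avoiding_powers a : (forall n, a ^+ n <> 0) ->
  exists P, [/\ two_sided_ideal P, forall n, ~ P (a ^+ n) &
    forall Q, two_sided_ideal Q -> P `<` Q -> exists n, Q (a ^+ n)].
Proof.
move=> a_neq0.
pose avoid X := two_sided_ideal X /\ forall n, ~ X (a ^+ n).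
have [|A [A_avoid A_max]] :=
    @Zorn_bigcup S [set X | X = set0 \/ avoid X].
  move=> F FP Ftot.
  have FQ X x : F X -> X x -> avoid X.
    by move=> /FP[-> //|].
  have [[X [FX [[X0 XB XMl XMr] _]]]|noF] := pselect (exists X, F X /\ avoid X).
    right; split; last by move=> n [Y FY Yan]; case: (FQ _ _ FY Yan) => _ /(_ n).
    split; first by exists X.
    - move=> x y [Y FY Yx] [Z FZ Zy].
      have [YZ|ZY] := Ftot _ _ FY FZ.
        by exists Z => //; case: (FQ _ _ FZ Zy) => /idealB h _; exact/h/Zy/YZ.
      by exists Y => //; case: (FQ _ _ FY Yx) => /idealB h _; exact/h/ZY/Zy.
    - move=> r x [Y FY Yx]; exists Y => //.
      by case: (FQ _ _ FY Yx) => /idealMl h _; exact: h.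
    - move=> r x [Y FY Yx]; exists Y => //.
      by case: (FQ _ _ FY Yx) => /idealMr h _; exact: h.
  left; apply/seteqP; split=> // x [Y FY Yx]; apply: noF; exists Y; split=> //.
  exact: FQ FY Yx.
case: A_avoid => [A0|[idA aA]].
  (* The empty set is not maximal: the zero ideal avoids the powers of [a], all nonzero. *)
  exfalso; apply: (A_max [set 0]).
    by rewrite A0; split=> [x|/(_ 0 erefl)].
  right; split=> [|n /=]; last exact: a_neq0.
  by split=> //= [x y -> ->|r x ->|r x ->]; rewrite ?subr0 ?mulr0 ?mul0r.
exists A; split=> // Q idQ AQ; apply: contrapT => /forallNP Qa.
by apply: (A_max Q AQ); right.
Qed.

(** If no power of [a] vanishes, an ideal maximal among those avoiding all powers of [a] is prime.
    Otherwise the annihilators [J] and [K], both strictly larger, contain powers of [a], whose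
    product falls into [K J] and hence into [P]. *)
Lemma prime_radical_nil a : prime_radical S a -> nilpotents S a.
Proof.
move=> Na; apply: contrapT => /forallNP a_neq0.
have [P [idP aP maxP]] := maximal_ideal_avoiding_powers a_neq0.
suff primeP : prime_ideal P by apply: (aP 1%N); exact: Na.
apply/prime_idealP => //; first by move=> PT; apply: (aP 0%N); rewrite PT.
move=> x y Pxy; apply: contrapT => /not_orP[nPx nPy].
pose J := [set z | forall r, P (x * r * z)].
have idJ : two_sided_ideal J by exact: two_sided_ideal_transporter.
pose K := [set z | forall u, J u -> P (z * u)].
have idK : two_sided_ideal K by exact: two_sided_ideal_residual.
have [|m Jm] := maxP J idJ.
  split; first by move=> z Pz r; exact: idealMl.
  by move=> /(_ y Pxy).
have [|n Kn] := maxP K idK.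
  split; first by move=> z Pz u _; exact: idealMr.
  by move=> /(_ x); apply: contra_not nPx; apply => u Ju; rewrite -[x]mulr1.
by apply: (aP (n + m)%N); rewrite exprD; exact: Kn.
Qed.

End PrimeIdeals.

(** * Central extensions and homomorphic images *)

Definition central_extension (R S : nzRingType) (phi : R -> S) : Prop :=
  forall s, exists2 l : seq (R * S), s = \sum_(p <- l) phi p.1 * p.2 &
    forall p, p \in l -> forall t, GRing.comm p.2 t.

(* The contraction of a prime ideal along a central extension is prime. *)
Lemma prime_radical_central_ext (R S : nzRingType) (phi : {rmorphism R -> S}) :
  central_extension phi ->
  forall a, prime_radical R a -> prime_radical S (phi a).
Proof.
move=> span a Na P PP; have [idP PT _] := PP.
have primeP := (prime_idealP idP PT).1 PP.
apply: (Na (phi @^-1` P)) => /=.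
have idphi : two_sided_ideal (phi @^-1` P).
  split=> /= [|x y Px Py|r x Px|r x Px].
  - by rewrite rmorph0; exact: ideal0.
  - by rewrite rmorphB; exact: idealB.
  - by rewrite rmorphM; exact: idealMl.
  - by rewrite rmorphM; exact: idealMr.
apply/prime_idealP => //.
  move=> phiT; apply: PT; apply/seteqP; split=> // s _.
  rewrite -[s]mulr1 -(rmorph1 phi); apply: idealMl => //.
  by have : (phi @^-1` P) 1 by rewrite phiT.
move=> x y Pxy; apply: primeP => // s; have [l -> lC] := span s.
rewrite mulr_sumr mulr_suml; apply: ideal_sum => // p pl _.
(* Moving the central factor to the right leaves [phi (x * p.1 * y) * p.2]. *)
rewrite -!mulrA (lC _ pl) !mulrA -!rmorphM.
by apply: idealMr => //; exact: Pxy.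
Qed.

Lemma nilpotents_rmorph (S R : pzRingType) (phi : {rmorphism S -> R}) a :
  nilpotents S a -> nilpotents R (phi a).
Proof. by move=> [n an]; exists n; rewrite -rmorphXn an rmorph0. Qed.

Lemma NC_rmorph (S R : pzRingType) (phi : {rmorphism S -> R}) a :
  NC S a -> NC R (phi a).
Proof.
move=> [e ee [n nn <-]]; rewrite rmorphD; exists (phi e) => /=.
  by rewrite /idempotents/= -rmorphM ee.
by exists (phi n) => //; exact: nilpotents_rmorph.
Qed.

Lemma nilpotentsM_comm (S : pzRingType) (a b : S) :
  GRing.comm a b -> nilpotents S a -> nilpotents S (a * b).
Proof. by move=> ab [n an]; exists n; rewrite exprMn_comm// an mul0r. Qed.

Lemma NC_nilpotent (S : pzRingType) (a : S) : nilpotents S a -> NC S a.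
Proof.
by move=> na; exists 0; [exact: mulr0|exists a => //; rewrite add0r].
Qed.

(* c f k is the coefficient of x^k in f. The product rule is stated with an
   unspecified finite index set r, which contains all nonzero terms. *)
Definition cauchy_coefs {R S : nzRingType} (c : S -> int -> R) : Prop :=
  [/\ forall k f g, c (f + g) k = c f k + c g k,
      forall f g k, exists2 r : seq int, uniq r &
        c (f * g) k = \sum_(i <- r) c f i * c g (k - i) /\
        forall i, i \notin r -> c f i * c g (k - i) = 0
    & forall f, exists m : int, forall i, i < m -> c f i = 0].

(** Serves lowest-coefficient arguments, with [m] a lower bound of the support. *)
Lemma int_ind_from (P : int -> Prop) (m : int) :
  (forall k, k < m -> P k) ->
  (forall k, (forall i, i < k -> P i) -> P k) -> forall k, P k.
Proof.
move=> Pm IH k; have [/Pm//|mk] := ltP k m.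
rewrite -(subrKC m k); have -> : k - m = `|k - m|%N :> int by lia.
elim/ltn_ind: `|k - m|%N => n IHn; apply: IH => i im.
have [/Pm//|mi] := ltP i m.
rewrite -(subrKC m i); have -> : i - m = `|i - m|%N :> int by lia.
by apply: IHn; lia.
Qed.

(** * Coefficients of nilpotents and idempotents modulo a reduced ideal *)

Section ReducedIdeal.
Context {R S : nzRingType} {c : S -> int -> R} {I : set R}.
Hypothesis cC : cauchy_coefs c.
Hypothesis idI : two_sided_ideal I.
Hypothesis redI : forall a, I (a * a) -> I a.

(** The two index sets are compared on their intersection: terms off [r] vanish and terms off [s]
    lie in [I]. *)
Lemma coef_mul_mod f g k (s : seq int) : uniq s ->
  (forall i, i \notin s -> I (c f i * c g (k - i))) ->
  I (c (f * g) k - \sum_(i <- s) c f i * c g (k - i)).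
Proof.
move=> us Is; case: cC => _ /(_ f g k)[r ur [-> r0]] _.
rewrite (bigID (mem s)) /= [X in _ - X](bigID (mem r)) /=.
rewrite [X in _ - (_ + X)]big1 ?addr0; last by move=> i; exact: r0.
have -> : \sum_(i <- r | i \in s) c f i * c g (k - i) =
          \sum_(i <- s | i \in r) c f i * c g (k - i).
  rewrite -big_filter -[RHS]big_filter; apply: perm_big.
  by apply: uniq_perm; rewrite ?filter_uniq// => i; rewrite !mem_filter andbC.
by rewrite addrAC subrr add0r; apply: ideal_sum => // i _; exact: Is.
Qed.

(** Two distinct indices with sum [k + k] include one below [k], so only the middle term survives
    modulo [I]. *)
Lemma coef_sqr_lowest f k : (forall i, i < k -> I (c f i)) ->
  I (c (f * f) (k + k) - c f k * c f k).
Proof.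
move=> lowI.
suff Ik i : i \notin [:: k] -> I (c f i * c f (k + k - i)).
  by have := coef_mul_mod (s := [:: k]) isT Ik; rewrite big_seq1 addrK.
rewrite inE => ik; have [|ki|ik0] := ltgtP i k; last by rewrite ik0 eqxx in ik.
  by move=> /lowI; exact: idealMr.
by apply: idealMl => //; apply: lowI; lia.
Qed.

Lemma coef_in_of_sqr f : (forall k, I (c (f * f) k)) -> forall k, I (c f k).
Proof.
move=> If; case: (cC) => _ _ /(_ f)[m fm].
apply: (@int_ind_from _ m) => [k /fm ->|k IH]; first exact: ideal0.
exact/redI/(ideal_congr idI (coef_sqr_lowest IH)).
Qed.

Lemma coef_nilpotent f : nilpotents S f -> forall k, I (c f k).
Proof.
have I0 k : I (c 0 k).
  case: (cC) => /(_ k 0 0) + _ _; rewrite addr0 -[LHS]addr0 => /addrI <-.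
  exact: ideal0.
move=> [n fn].
(* Since [n < 2 ^ n], this power is zero too, and it can be undone by [n] square roots. *)
have : forall k, I (c (f ^+ (2 ^ n)) k).
  by rewrite -(subnK (ltnW (ltn_expl n (leqnn 2)))) exprD fn mulr0.
elim: n f {fn} => [//|n IHn] f If; apply/coef_in_of_sqr/IHn => k.
by rewrite -expr2 -exprM -expnS.
Qed.

(** Multiplying [b = a b + b a] by [a] on the left, with [a a = a], gives [a b a = 0] modulo [I].
    Hence [a b] and [b a] square to zero there, so reducedness kills both, and [b] with them. *)
Lemma idempotent_coef_step a b :
  I (a * a - a) -> I (b - (a * b + b * a)) -> I b.
Proof.
move=> Iaa Ib.
have Iaba : I (a * b * a).
  have -> : a * b * a = - (a * (b - (a * b + b * a)) + (a * a - a) * b).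
    by rewrite mulrBr mulrDr mulrBl !mulrA opprD !opprB addrA subrK addrAC subrr
               add0r.
  by apply: idealN => //; apply: idealD => //; [exact: idealMl|exact: idealMr].
have Iab : I (a * b) by apply: redI; rewrite mulrA; exact: idealMr.
have Iba : I (b * a) by apply: redI; rewrite -mulrA (mulrA a); exact: idealMl.
by rewrite -(subrK (a * b + b * a) b); apply: idealD => //; exact: idealD.
Qed.

Lemma coef_idempotent e : idempotents S e -> forall k, k != 0 -> I (c e k).
Proof.
rewrite /idempotents/= => ee; case: (cC) => _ _ /(_ e)[m em].
(* For negative [k] the degree [k + k] lies below [k], so the square of the coefficient at [k] is
   already in [I]. *)
have Ineg k : k < 0 -> I (c e k).
  move: k; apply: (@int_ind_from _ m) => [k /em -> _|k IH k0]; first exact: ideal0.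
  have low i : i < k -> I (c e i) by move=> ik; apply: IH => //; lia.
  apply/redI/(ideal_congr idI (coef_sqr_lowest low)).
  by rewrite ee; apply: low; lia.
apply: (@int_ind_from _ 0) => [k /Ineg//|k IH k0].
have [/Ineg//|k_ge0] := ltP k 0.
apply: (@idempotent_coef_step (c e 0)).
  rewrite -opprB; apply: idealN => //.
  by have := coef_sqr_lowest Ineg; rewrite ee addr0.
(* For any other [i], either [i] or [k - i] is negative, or [i] lies strictly between 0 and [k] and
   the induction hypothesis applies. *)
have I0k i : i \notin [:: 0; k] -> I (c e i * c e (k - i)).
  rewrite !inE => i0k; have [|i_ge0] := ltP i 0.
    by move=> /Ineg; exact: idealMr.
  have [ik|ki] := ltP i k; first by apply: idealMr => //; apply: IH; lia.
  by apply: idealMl => //; apply: Ineg; lia.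
have u0k : uniq [:: 0; k] by rewrite /= inE eq_sym k0.
have := coef_mul_mod u0k I0k.
by rewrite big_cons big_seq1 subr0 subrr ee.
Qed.

End ReducedIdeal.

Lemma NC_coef (R S : nzRingType) (c : S -> int -> R) : cauchy_coefs c ->
  two_primal R -> forall f, NC S f -> forall k, k != 0 ->
  prime_radical R (c f k).
Proof.
move=> cC tpR _ [e ee [n nn <-]] k k0.
have idN := @two_sided_ideal_prime_radical R.
(* By 2-primality the radical is the set of nilpotents, and [a] is nilpotent once [a * a] is. *)
have redN a : prime_radical R (a * a) -> prime_radical R a.
  by rewrite tpR => -[m am]; exists (2 * m)%N; rewrite exprM.
case: (cC) => -> _ _; apply: (idealD idN).
  exact: (coef_idempotent cC idN redN).
exact: (coef_nilpotent cC idN redN).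
Qed.

Lemma two_primalP (R : nzRingType) :
  two_primal R <-> nilpotents R `<=` prime_radical R.
Proof.
split=> [-> //|nilN]; apply/seteqP; split=> // a; exact: prime_radical_nil.
Qed.

(** A sum of nilpotents need not be nilpotent, but [phi n] and [g] both lie in the prime radical of
    [S], a nil ideal; [phi e] is the idempotent part. *)
Lemma NC_central_extension (R S : nzRingType) (phi : {rmorphism R -> S}) :
  central_extension phi -> two_primal R ->
  forall a g, NC R a -> prime_radical S g -> NC S (phi a + g).
Proof.
move=> phiZ tpR _ g [e ee [n nn <-]] Ng.
exists (phi e); first by rewrite /idempotents/= -rmorphM ee.
exists (phi n + g); last by rewrite rmorphD addrA.
apply: prime_radical_nil; apply: (idealD (@two_sided_ideal_prime_radical S)) => //.
by apply: prime_radical_central_ext => //; rewrite tpR.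
Qed.

(** * Polynomials and power series *)

Section PowerSeries.
Variable R : nzRingType.

(* Coefficients of index nat, extended by 0 to index int so that all three
   rings are instances of cauchy_coefs. *)
Definition zext (u : nat -> R) (k : int) : R := if k is Posz n then u n else 0.

Lemma zext_cauchy (S : nzRingType) (u : S -> nat -> R) :
  (forall f g n, u (f + g) n = u f n + u g n) ->
  (forall f g n, u (f * g) n = \sum_(i < n.+1) u f i * u g (n - i)%N) ->
  cauchy_coefs (fun f => zext (u f)).
Proof.
move=> uD uM; split; first by move=> [n|n] f g /=; rewrite ?addr0.
- move=> f g [n|n].
    exists (map Posz (index_iota 0 n.+1)).
      by rewrite map_inj_uniq ?iota_uniq// => i j [].
    split.
      rewrite big_map big_mkord [LHS]uM; apply: eq_bigr => i _.
      by rewrite subzn // -ltnS.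
    case=> [i|i]; last by rewrite mul0r.
    rewrite mem_map; last by move=> ? ? [].
    rewrite mem_index_iota /= -ltnNge => lt_ni.
    (* [Negz m] is [-(m + 1)], hence the predecessor; [zext] is zero there. *)
    have -> : (n%:Z - i%:Z)%R = Negz (i - n).-1 by lia.
    by rewrite mulr0.
  exists [::] => //; split; first by rewrite big_nil.
  case=> [i|i] _ /=; last by rewrite mul0r.
  have -> : (Negz n - i%:Z)%R = Negz (n + i) by lia.
  by rewrite mulr0.
- by move=> f; exists 0 => -[].
Qed.

Lemma poly_cauchy : cauchy_coefs (fun f : {poly R} => zext (fun n => f`_n)).
Proof. by apply: zext_cauchy => f g n; rewrite ?coefD ?coefM. Qed.

Lemma fps_cauchy : cauchy_coefs (fun f : fps R => zext f).
Proof. exact: zext_cauchy. Qed.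

Lemma polyC_central_extension : central_extension (@polyC R).
Proof.
move=> s; exists [seq (s`_i, 'X^i) | i <- iota 0 (size s)].
  rewrite big_map -[LHS]coefK poly_def -(big_mkord xpredT (fun i => s`_i *: 'X^i)).
  by rewrite /index_iota subn0; apply: eq_bigr => i _; rewrite mul_polyC.
by move=> _ /mapP[i _ ->] t /=; exact/commr_sym/commr_polyXn.
Qed.

Lemma poly_coefs_prime_radical (f : {poly R}) :
  poly_coefs_in (prime_radical R) f -> prime_radical {poly R} f.
Proof.
move=> Nf; rewrite -[f]coefK poly_def.
apply: (ideal_sum (@two_sided_ideal_prime_radical _)) => i _ _.
rewrite -mul_polyC; apply: (idealMr (@two_sided_ideal_prime_radical _)).
exact: (prime_radical_central_ext polyC_central_extension).
Qed.

Definition fps_coef0 (f : fps R) : R := f 0%N.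

Fact fps_coef0_is_zmod_morphism : zmod_morphism fps_coef0.
Proof. by []. Qed.

Fact fps_coef0_is_monoid_morphism : monoid_morphism fps_coef0.
Proof. by split=> // f g; rewrite /fps_coef0 /= big_ord1. Qed.

HB.instance Definition _ := GRing.isZmodMorphism.Build (fps R) R fps_coef0
  fps_coef0_is_zmod_morphism.
HB.instance Definition _ := GRing.isMonoidMorphism.Build (fps R) R fps_coef0
  fps_coef0_is_monoid_morphism.

Lemma fps_coefD (f g : fps R) n : (f + g) n = f n + g n.
Proof. by []. Qed.

Lemma fps_mulX (f : fps R) n : (f * fpsX) n.+1 = f n.
Proof.
rewrite [LHS]/= (bigD1 (inord n)) //= inordK // subSnn mulr1 big1 ?addr0 // => i.
rewrite -val_eqE /= inordK // => ne; case: eqP => [e|]; last by rewrite mulr0.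
by case/eqP: ne; move: (ltn_ord i) e; lia.
Qed.

Lemma fps_mulX0 (f : fps R) : (f * fpsX) 0%N = 0.
Proof. by rewrite [LHS]/= big_ord1 mulr0. Qed.

Lemma fpsX_comm (f : fps R) : GRing.comm f fpsX.
Proof.
apply/fpsP => -[|n]; first by rewrite fps_mulX0 [RHS]/= big_ord1 mul0r.
rewrite fps_mulX [RHS]/= !big_ord_recl /= mul0r add0r mul1r subn1 /=.
by rewrite big1 ?addr0 // => i _; rewrite mul0r.
Qed.

Lemma nilpotents_fpsC (a : R) : nilpotents R a -> nilpotents (fps R) (fpsC a).
Proof.
move=> [n an]; exists n; suff -> : fpsC a ^+ n = fpsC (a ^+ n).
  by rewrite an; apply/fpsP => k /=; rewrite mul0rn.
elim: n {an} => [|n IHn]; first by apply/fpsP => k; rewrite expr0.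
rewrite !exprS IHn; apply/fpsP => k /=; rewrite big_ord_recl /= mulr1n subn0.
rewrite big1 ?addr0; first by rewrite mulrnAr.
by move=> i _; rewrite mulr0n mul0r.
Qed.

End PowerSeries.

(** * Laurent polynomials *)

Section Laurent.
Variable R : nzRingType.
Implicit Types f g : laurent R.

Lemma sum_indicator (T : eqType) (s : seq T) (F : T -> R) (j : T) : uniq s ->
  (j \notin s -> F j = 0) -> \sum_(i <- s) F i *+ (i == j) = F j.
Proof.
move=> us Fj; have [js|/[dup] js /Fj ->] := boolP (j \in s).
  rewrite (bigD1_seq j) //= eqxx big1 ?addr0 // => i /negbTE ->.
  by rewrite mulr0n.
rewrite big_seq big1 // => i si; case: eqP => [ij|]; last by rewrite mulr0n.
by rewrite -ij si in js.
Qed.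

Lemma laurent_coefM f g k :
  (f * g)@_k = \sum_(i <- msupp f) f@_i * g@_(k - i).
Proof.
rewrite [f * g]/(laurent_mul f g) /laurent_mul raddf_sum; apply: eq_bigr => i _.
rewrite raddf_sum /= -(@sum_indicator _ (msupp g) (fun j => f@_i * g@_j)).
- apply: eq_bigr => j _; rewrite mcoeffU; congr (_ *+ nat_of_bool _).
  by rewrite -subr_eq opprK; lia.
- exact: fset_uniq.
- by move=> /mcoeff_outdom ->; rewrite mulr0.
Qed.

Lemma laurent_coefM_monom f (c : R) (j k : int) :
  (f * laurent_monom c j)@_k = f@_(k - j) * c.
Proof.
rewrite laurent_coefM -(@sum_indicator _ (msupp f) (fun i => f@_i * c)).
- apply: eq_bigr => i _; rewrite mcoeffU mulrnAr; congr (_ *+ nat_of_bool _).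
  by lia.
- exact: fset_uniq.
- by move=> /mcoeff_outdom ->; rewrite mul0r.
Qed.

Lemma int_seq_lbound (s : seq int) : exists m : int, forall i, i \in s -> m <= i.
Proof.
elim: s => [|j s [m ms]]; first by exists 0.
exists (Num.min j m) => i; rewrite inE ge_min => /orP[/eqP ->|/ms ->].
  by rewrite lexx.
by rewrite orbT.
Qed.

Lemma laurent_cauchy : cauchy_coefs (fun f (k : int) => f@_k).
Proof.
split; first by move=> k f g; exact: mcoeffD.
- move=> f g k; exists (msupp f); first exact: fset_uniq.
  split; first exact: laurent_coefM.
  by move=> i /mcoeff_outdom ->; rewrite mul0r.
- move=> f; have [m mf] := int_seq_lbound (msupp f).
  exists m => i im; apply: mcoeff_outdom; apply: contraTN im => /mf.
  by rewrite leNgt.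
Qed.

Fact laurentC_is_zmod_morphism : zmod_morphism (@laurentC R).
Proof. by move=> a b; exact: monalgUB. Qed.

Fact laurentC_is_monoid_morphism : monoid_morphism (@laurentC R).
Proof. by split=> // a b; rewrite [RHS]laurent_mulUU addr0. Qed.

HB.instance Definition _ := GRing.isZmodMorphism.Build R (laurent R) (@laurentC R)
  laurentC_is_zmod_morphism.
HB.instance Definition _ := GRing.isMonoidMorphism.Build R (laurent R) (@laurentC R)
  laurentC_is_monoid_morphism.

Lemma laurent_monomE (c : R) k :
  laurent_monom c k = laurentC c * laurent_monom 1 k.
Proof. by rewrite [RHS]laurent_mulUU mulr1 add0r. Qed.

Lemma laurent_monom1_comm (k : int) f : GRing.comm (laurent_monom 1 k) f.
Proof.
rewrite /GRing.comm (laurentE f) mulr_sumr mulr_suml; apply: eq_bigr => i _.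
by rewrite [LHS]laurent_mulUU [RHS]laurent_mulUU mul1r mulr1 addrC.
Qed.

Lemma laurentC_central_extension : central_extension (@laurentC R).
Proof.
move=> s; exists [seq (s@_i, laurent_monom 1 i) | i <- msupp s].
  by rewrite big_map [LHS]laurentE; apply: eq_bigr => i _; exact: laurent_monomE.
by move=> _ /mapP[i _ ->] t; exact: laurent_monom1_comm.
Qed.

Lemma laurent_coefs_prime_radical f :
  laurent_coefs_in (prime_radical R) f -> prime_radical (laurent R) f.
Proof.
move=> Nf; rewrite (laurentE f).
apply: (ideal_sum (@two_sided_ideal_prime_radical _)) => i _ _.
rewrite laurent_monomE; apply: (idealMr (@two_sided_ideal_prime_radical _)).
exact: (prime_radical_central_ext laurentC_central_extension).
Qed.

(* Evaluation at x = 1. The constant coefficient is not multiplicative on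
   Laurent polynomials, and this homomorphism stands in for it. *)
Definition laurent_eval1 (f : laurent R) : R := mmap idfun (fun=> 1) f.

Lemma laurent_eval1E f : laurent_eval1 f = \sum_(i <- msupp f) f@_i.
Proof. by apply: eq_bigr => i _; rewrite mulr1. Qed.

Fact laurent_eval1_is_zmod_morphism : zmod_morphism laurent_eval1.
Proof. by move=> f g; rewrite /laurent_eval1 raddfB. Qed.

HB.instance Definition _ := GRing.isZmodMorphism.Build (laurent R) R laurent_eval1
  laurent_eval1_is_zmod_morphism.

Lemma laurent_eval1_monom c k : laurent_eval1 (laurent_monom c k) = c.
Proof. by rewrite /laurent_eval1 mmapU mulr1. Qed.

Fact laurent_eval1_is_monoid_morphism : monoid_morphism laurent_eval1.
Proof.
split=> [|f g]; first exact: laurent_eval1_monom.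
rewrite [f * g]/(laurent_mul f g) /laurent_mul !raddf_sum !laurent_eval1E.
rewrite mulr_suml; apply: eq_bigr => i _; rewrite raddf_sum mulr_sumr.
by apply: eq_bigr => j _; exact: laurent_eval1_monom.
Qed.

HB.instance Definition _ := GRing.isMonoidMorphism.Build (laurent R) R laurent_eval1
  laurent_eval1_is_monoid_morphism.

End Laurent.

(** * The three characterizations *)

Theorem theorem2p5 (R : nzRingType) :
  [/\ two_primal R <->
        NC {poly R} =
          (polyC @` NC R)
            [+] [set f * 'X | f in poly_coefs_in (prime_radical R)],
      two_primal R <->
        NC (laurent R) =
          [set f * laurentXV | f in laurent_coefs_in (prime_radical R)]
            [+] (@laurentC R @` NC R)
            [+] [set f * laurentX | f in laurent_coefs_in (prime_radical R)]
    & two_primal R <->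
        NC (fps R) `<=`
          (@fpsC R @` NC R)
            [+] [set f * fpsX | f in fps_coefs_in (prime_radical R)]].
Proof.
have idN (S : nzRingType) := @two_sided_ideal_prime_radical S.
split; split.
- move=> tpR; apply/seteqP; split=> [f NCf|_ [_ [a NCa <-]] [_ [f Nf <-] <-]].
    exists (f`_0)%:P.
      by exists f`_0 => //; exact: (@NC_rmorph _ _ (coefp 0)).
    exists (drop_poly 1 f * 'X); first exists (drop_poly 1 f) => //.
      move=> i; rewrite coef_drop_poly addn1.
      exact: (NC_coef (@poly_cauchy R) tpR NCf (k := i.+1)).
    apply/polyP => -[|i]; rewrite coefD coefC coefMX /= ?addr0//.
    by rewrite add0r coef_drop_poly addn1.
  apply: (NC_central_extension (@polyC_central_extension R)) => //.
  by apply: (idealMr (idN _)); exact: poly_coefs_prime_radical.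
- move=> eqNC; apply/two_primalP => a na.
  have : NC {poly R} (a%:P * 'X).
    apply: NC_nilpotent; apply: nilpotentsM_comm; first exact: commr_polyX.
    exact: (@nilpotents_rmorph _ _ polyC).
  (* Comparing coefficients of [x] identifies [a] with the constant coefficient of [f]. *)
  rewrite eqNC => -[_ [b _ <-]] [_ [f Nf <-]] /polyP/(_ 1%N).
  by rewrite coefD coefC !coefMX coefC /= add0r => <-.
- move=> tpR; apply/seteqP; split=> [f NCf|].
    have Nf k : k != 0 -> prime_radical R f@_k.
      exact: (NC_coef (@laurent_cauchy R) tpR NCf).
    pose a := laurent_eval1 f; pose g := f - laurentC a.
    have gk k : g@_k = f@_k - a *+ (0 == k) by rewrite mcoeffB mcoeffU.
    have Ng : laurent_coefs_in (prime_radical R) g.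
      move=> k; rewrite gk; case: eqP => [<-|/eqP k0]; last first.
        by rewrite subr0; apply: Nf; rewrite eq_sym.
      (* The constant coefficient of [g] is minus the sum of the nonconstant coefficients of [f],
         all in the radical. *)
      rewrite mulr1n /a laurent_eval1E.
      have -> : f@_0 = \sum_(i <- msupp f) f@_i *+ (i == 0).
        rewrite sum_indicator ?fset_uniq //.
        exact: mcoeff_outdom.
      rewrite -sumrB; apply: (ideal_sum (idN R)) => i _ _.
      have [->|i0] := eqVneq i 0; first by rewrite subrr; exact: ideal0.
      by rewrite mulr0n sub0r; apply: (idealN (idN R)); exact: Nf.
    (* The decomposition is not unique: all of [g], written as [(g x) x^-1], goes into the left
       summand, and the right one is 0. *)
    exists (g * laurentX * laurentXV + laurentC a).
      exists (g * laurentX * laurentXV).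
        exists (g * laurentX) => // k.
        by rewrite laurent_coefM_monom mulr1; exact: Ng.
      by exists (laurentC a) => //; exists a => //; exact: NC_rmorph.
    exists 0; first by exists 0; rewrite ?mul0r// => k; rewrite mcoeff0; exact: ideal0.
    by rewrite -mulrA (laurentXK R).1 mulr1 addr0 subrK.
  move=> _ [_ [_ [f Nf <-]] [_ [a NCa <-]] <-] [_ [g Ng <-] <-].
  rewrite addrAC [_ + laurentC a]addrC.
  apply: (NC_central_extension (@laurentC_central_extension R)) => //.
  by apply: (idealD (idN _)); apply: (idealMr (idN _));
    exact: laurent_coefs_prime_radical.
- move=> eqNC; apply/two_primalP => a na.
  have : NC (laurent R) (laurentC a * laurentX).
    apply: NC_nilpotent; apply: nilpotentsM_comm.
      exact/commr_sym/laurent_monom1_comm.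
    exact: nilpotents_rmorph.
  rewrite eqNC => -[_ [_ [f Nf <-]] [_ [b _ <-]] <-] [_ [g Ng <-]].
  (* At [x^1] the left summand contributes [f@_2], the constant nothing, and the right summand
     [g@_0]. *)
  move=> /(congr1 (fun h : laurent R => h@_1)).
  rewrite !mcoeffD !laurent_coefM_monom !mulr1 !mcoeffU /= addr0 mulr1n => <-.
  by apply: (idealD (idN R)); [exact: Nf|exact: Ng].
- move=> tpR f NCf.
  exists (fpsC (f 0%N)).
    by exists (f 0%N) => //; exact: (@NC_rmorph _ _ (@fps_coef0 R)).
  (* The shifted series is [(f - f 0) / x]. *)
  exists (FPS (fun n => f n.+1) * fpsX); first exists (FPS (fun n => f n.+1)) => //.
    by move=> n; exact: (NC_coef (@fps_cauchy R) tpR NCf (k := n.+1)).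
  apply/fpsP => -[|n]; rewrite fps_coefD.
    by rewrite fps_mulX0 addr0.
  by rewrite fps_mulX add0r.
- move=> subNC; apply/two_primalP => a na.
  have : NC (fps R) (fpsC a * fpsX).
    apply: NC_nilpotent; apply: nilpotentsM_comm; first exact: fpsX_comm.
    exact: nilpotents_fpsC.
  move=> /subNC[_ [b _ <-]] [_ [f Nf <-]] /fpsP/(_ 1%N).
  rewrite fps_coefD !fps_mulX /= add0r mulr1n => <-.
  exact: Nf.
Qed.
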